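(* Let $\boldsymbol{x}_1,\dots,\boldsymbol{x}_T\in\mathbb{R}^{N_x}$ be inputs with labels in $\{1,\dots,N_y\}$, and let $\boldsymbol{y}_t\in\{0,1\}^{N_y}$ be the one-hot encoding of the $t$-th label. Fix $\boldsymbol{\theta}$ and write $\boldsymbol{\phi}_t:=\boldsymbol{\phi}(\boldsymbol{x}_t,\boldsymbol{\theta})\in\mathbb{R}^{N_\phi}$. Consider the discriminative classification model in which, given $W\in\mathbb{R}^{N_y\times N_\phi}$, the label of $\boldsymbol{x}_t$ is distributed according to $\mathrm{softmax}(\boldsymbol{z}_t)$ with logits $\boldsymbol{z}_t=W\boldsymbol{\phi}_t+\boldsymbol{\varepsilon}_t$, where $\boldsymbol{\varepsilon}_t\sim\mathcal{N}(0,\Sigma)$ are i.i.d. and independent of $W$, $\Sigma=\mathrm{diag}(\sigma_1^2,\dots,\sigma_{N_y}^2)$ with $\sigma_k^2\ge0$, and $W$ has a Gaussian prior $p(W)$. Let $q(W\mid\boldsymbol{\eta})=\prod_{k=1}^{N_y}\mathcal{N}(\bar{\boldsymbol{w}}_k,S_k)$ be the variational posterior under which the rows $\boldsymbol{w}_k$ of $W$ are independent with $\boldsymbol{w}_k\sim\mathcal{N}(\bar{\boldsymbol{w}}_k,S_k)$, and let $\bar W$ be the matrix with rows $\bar{\boldsymbol{w}}_k^\top$. Then $$\frac1T\log p(Y\mid X,\boldsymbol{\theta})\;\ge\;\mathcal{L}(\boldsymbol{\theta},\boldsymbol{\eta},\Sigma)-\frac1T\,\mathrm{KL}\big(q(W\mid\boldsymbol{\eta})\,\|\,p(W)\big),$$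 where $$\mathcal{L}(\boldsymbol{\theta},\boldsymbol{\eta},\Sigma)=\frac1T\sum_{t=1}^T\Big(\boldsymbol{y}_t^\top\bar W\boldsymbol{\phi}_t-\mathrm{LSE}_k\big[\bar{\boldsymbol{w}}_k^\top\boldsymbol{\phi}_t+\tfrac12\big(\boldsymbol{\phi}_t^\top S_k\boldsymbol{\phi}_t+\sigma_k^2\big)\big]\Big).$$
   Context: $\boldsymbol{\phi}:\mathbb{R}^{N_x}\times\Theta\to\mathbb{R}^{N_\phi}$ is an arbitrary fixed feature map (a neural network without its last layer, with weights $\boldsymbol{\theta}\in\Theta$). $X,Y$ denote the stacked inputs and labels. $\mathrm{LSE}_k[a_k]=\log\sum_{k=1}^{N_y}e^{a_k}$, and $\mathrm{softmax}(\boldsymbol{z})_k=e^{z_k}/\sum_j e^{z_j}$. The $S_k\in\mathbb{R}^{N_\phi\times N_\phi}$ are symmetric positive definite covariance matrices, $\boldsymbol{\eta}=\{(\bar{\boldsymbol{w}}_k,S_k)\}_{k=1}^{N_y}$, and $p(W)$ is a (nondegenerate) Gaussian distribution on $\mathbb{R}^{N_y\times N_\phi}$. The marginal likelihood is $p(Y\mid X,\boldsymbol{\theta})=\mathbb{E}_{W\sim p(W)}\big[\prod_{t=1}^T\mathbb{E}_{\boldsymbol{\varepsilon}_t\sim\mathcal{N}(0,\Sigma)}[\boldsymbol{y}_t^\top\mathrm{softmax}(W\boldsymbol{\phi}_t+\boldsymbol{\varepsilon}_t)]\big]$; when some $\sigma_k^2=0$ the corresponding noise component is identically $0$. $\mathrm{KL}$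 denotes Kullback--Leibler divergence. *)

(* Defs.v *)
From HB Require Import structures.
From mathcomp Require Import all_boot all_order all_algebra.
From mathcomp Require Import all_classical all_reals all_analysis.

Set Implicit Arguments.
Unset Strict Implicit.
Unset Printing Implicit Defensive.

Import Order.TTheory GRing.Theory Num.Theory.
Import numFieldNormedType.Exports.

Local Open Scope classical_set_scope.
Local Open Scope ring_scope.

(* The Borel sigma-algebra of R^(m x n), as the product sigma-algebra. *)
Definition mx_measurable (R : realType) (m n : nat) : set (set 'M[R]_(m, n)) :=
  <<s [set A | exists i j (B : set R),
         measurable B /\ A = [set M : 'M[R]_(m, n) | B (M i j)]] >>.

Definition measure_mx_display : measure_display.
Proof. exact: default_measure_display. Qed.

Section mx_measurable_instance.
Variables (R : realType) (m n : nat).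

Let mx_measurable0 : @mx_measurable R m n set0.
Proof. exact: sigma_algebra0. Qed.

Let mx_measurableC A : @mx_measurable R m n A -> mx_measurable (~` A).
Proof. exact: sigma_algebraC. Qed.

Let mx_measurable_bigcup (F : (set 'M[R]_(m, n))^nat) :
  (forall i, mx_measurable (F i)) -> mx_measurable (\bigcup_i F i).
Proof. exact: sigma_algebra_bigcup. Qed.

HB.instance Definition _ := @isMeasurable.Build measure_mx_display
  'M[R]_(m, n) (@mx_measurable R m n)
  mx_measurable0 mx_measurableC mx_measurable_bigcup.

End mx_measurable_instance.

Section gaussian.
Variable R : realType.

Definition dotv n (u v : 'cV[R]_n) : R := (u^T *m v) 0 0.

Definition posdefmx n (S : 'M[R]_n) : Prop :=
  S^T = S /\ forall u : 'cV[R]_n, u != 0 -> 0 < dotv u (S *m u).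

(* The law N(m, v) on R with variance v >= 0. The case v = 0 is separate
   because normal_prob m 0 is, by convention, the uniform law on [0, 1]. *)
Definition normal_law (m v : R) (A : set R) : \bar R :=
  if v == 0 then \d_m A else normal_prob m (Num.sqrt v) A.

(* mu is the law N(m, S) on R^n: for X ~ mu, every linear combination u^T X
   follows N(u^T m, u^T S u). S may be singular. *)
Definition gaussian_law n (mu : set 'cV[R]_n -> \bar R)
    (m : 'cV[R]_n) (S : 'M[R]_n) : Prop :=
  forall (u : 'cV[R]_n) (A : set R), measurable A ->
    mu [set x | A (dotv u x)] = normal_law (dotv u m) (dotv u (S *m u)) A.

Definition rowv m n (k : 'I_m) (W : 'M[R]_(m, n)) : 'cV[R]_n := (row k W)^T.

(* A nondegenerate Gaussian law on R^(m x n), identified with R^(m n) through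
   mxvec; the entries may be arbitrarily correlated. *)
Definition gaussian_mx_law m n (p : set 'M[R]_(m, n) -> \bar R) : Prop :=
  exists (mu0 : 'cV[R]_(m * n)) (S0 : 'M[R]_(m * n)),
    posdefmx S0 /\ gaussian_law (pushforward p (fun W => (mxvec W)^T)) mu0 S0.

Definition gaussian_rows_law m n (q : set 'M[R]_(m, n) -> \bar R)
    (w : 'I_m -> 'cV[R]_n) (S : 'I_m -> 'M[R]_n) : Prop :=
  (forall k, gaussian_law (pushforward q (rowv k)) (w k) (S k)) /\
  (forall B : 'I_m -> set 'cV[R]_n, (forall k, measurable (B k)) ->
    q [set W | forall k, B k (rowv k W)] =
      (\prod_(k < m) q [set W | B k (rowv k W)])%E).

End gaussian.

Section divergence.
Context d (X : measurableType d) (R : realType).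
Local Open Scope charge_scope.

Definition KL (q p : probability X R) : \bar R :=
  if pselect (q `<< p) then (\int[q]_x lne (('d (charge_of_finite_measure q) '/d p) x))%E else +oo%E.

End divergence.

Section model.
Variable R : realType.

Definition softmax n (z : 'cV[R]_n) : 'cV[R]_n :=
  \col_k (expR (z k 0) / \sum_j expR (z j 0)).

Definition LSE n (a : 'I_n -> R) : R := ln (\sum_k expR (a k)).

Definition onehot n (c : 'I_n) : 'cV[R]_n := \col_k (k == c)%:R.

(* p(Y | X, theta) for features phi_t and labels c_t, where p is the law of W
   and nu the common law of the noise vectors. *)
Definition marginal_likelihood (T Ny Nphi : nat)
    (phi : 'I_T -> 'cV[R]_Nphi) (c : 'I_T -> 'I_Ny)
    (p : probability 'M[R]_(Ny, Nphi) R) (nu : probability 'cV[R]_Ny R) :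
    \bar R :=
  'E_p[fun W => \prod_(t < T)
         fine 'E_nu[fun e => dotv (onehot (c t)) (softmax (W *m phi t + e))]].

Definition variational_objective (T Ny Nphi : nat)
    (phi : 'I_T -> 'cV[R]_Nphi) (c : 'I_T -> 'I_Ny)
    (w : 'I_Ny -> 'cV[R]_Nphi) (S : 'I_Ny -> 'M[R]_Nphi)
    (sigma2 : 'rV[R]_Ny) : R :=
  let Wbar := \matrix_(k < Ny) (w k)^T in
  T%:R^-1 * \sum_(t < T)
    (dotv (onehot (c t)) (Wbar *m phi t) -
     LSE (fun k => dotv (w k) (phi t) +
                   2^-1 * (dotv (phi t) (S k *m phi t) + sigma2 0 k))).

End model.

(* Main.v *)
(* Everything rests on convexity in the form of tangent-line bounds. Over the noise, the bounds
   [exp y >= 1 + y] and [ln u <= ln V + u / V - 1], taken at the mean [V] of the normalizing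
   sum, give E[softmax(z + e)_c] >= exp (z_c - LSE_k(z_k + sigma_k^2 / 2)) by the Gaussian
   moment generating function. The same bound on [ln] over the posterior replaces that LSE by
   the one of the objective, which leaves an explicit [h] with prod_t E[softmax] >= exp h and
   E_q h = T L. The Gibbs variational inequality E_q h - KL(q || p) <= ln E_p exp h concludes. *)

Require Import Defs.
From HB Require Import structures.
From mathcomp Require Import all_boot all_order all_algebra.
From mathcomp Require Import all_classical all_reals all_analysis.
From mathcomp Require Import measurable_realfun ring lra.

Import Order.TTheory GRing.Theory Num.Theory.
Import numFieldNormedType.Exports.

Set Implicit Arguments.
Unset Strict Implicit.

Local Open Scope classical_set_scope.
Local Open Scope ring_scope.

(** * Monotonicity of extended integrals and measurability of [lne] *)

Section integral_complements.
Context d (X : measurableType d) (R : realType).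
Local Open Scope ereal_scope.

(* Holds for arbitrary [f] and [g] because the integral of a nonnegative function is a supremum
   over simple functions and the sum of extended reals is monotone even at oo - oo. *)
Lemma integral_mono (mu : {measure set X -> \bar R}) (f g : X -> \bar R) :
  (forall x, f x <= g x) -> \int[mu]_x f x <= \int[mu]_x g x.
Proof.
have mono (u v : X -> \bar R) : (forall x, 0 <= u x) -> (forall x, u x <= v x) ->
    \int[mu]_x u x <= \int[mu]_x v x.
  move=> u0 uv; have v0 x : 0 <= v x := le_trans (u0 x) (uv x).
  rewrite !ge0_integralTE//; apply: ereal_sup_le => _ [h /= hu <-].
  by exists h => //= x; exact: le_trans (hu x) (uv x).
move=> fg; rewrite integralE [leRHS]integralE; apply: leeB; apply: mono => // x.
- by apply: (funepos_le (D := setT)) => [y _|]; rewrite ?inE.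
- by apply: (funeneg_le (D := setT)) => [y _|]; rewrite ?inE.
Qed.

(** Splitting into positive and negative parts avoids integrability, which the logarithm of a
    density may lack. *)
Lemma ae_le_integral (mu : {measure set X -> \bar R}) (f g : X -> \bar R) :
  measurable_fun setT f -> measurable_fun setT g ->
  {ae mu, forall x, f x <= g x} -> \int[mu]_x f x <= \int[mu]_x g x.
Proof.
move=> mf mg fg; rewrite integralE [leRHS]integralE; apply: leeB.
- apply: ae_ge0_le_integral => //; [exact: measurable_funepos..|].
  apply: filterS fg => x fgx _; rewrite !funeposE.
  by rewrite ge_max !le_max lexx orbT fgx.
- apply: ae_ge0_le_integral => //; [exact: measurable_funeneg..|].
  apply: filterS fg => x fgx _; rewrite !funenegE.
  by rewrite ge_max !le_max lexx orbT leeN2 fgx.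
Qed.

Lemma measurable_lne : measurable_fun [set: \bar R] (@lne R).
Proof.
rewrite (_ : @lne R = fun x => if x <= 0 then -oo else er_map (@ln R) x).
  apply: measurable_fun_ifT => //; last exact: measurable_er_map.
  exact: measurable_fun_lee.
by apply/funext => -[r| |] /=; rewrite ?lee_fin ?leNye ?leye_eq.
Qed.

End integral_complements.

(** * Calculus of integrable functions with known mean *)

Section has_mean.
Context d (X : measurableType d) (R : realType) (P : probability X R).
Implicit Types f g : X -> R.

Lemma expectationE f : ('E_P[f] = \int[P]_x (f x)%:E)%E.
Proof. by rewrite unlock. Qed.

(** Carrying integrability along with the value lets means of linear combinations be computed
    without side conditions. *)
Definition has_mean f (a : R) :=
  P.-integrable setT (EFin \o f) /\ (\int[P]_x (f x)%:E = a%:E)%E.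

Lemma has_mean_measurable f a : has_mean f a -> measurable_fun setT f.
Proof. by move=> [/measurable_int/measurable_EFinP]. Qed.

Lemma has_mean_cst a : has_mean (fun=> a) a.
Proof.
split; first exact: finite_measure_integrable_cst.
by rewrite integral_cst//= probability_setT mule1.
Qed.

Lemma has_meanD f g a b :
  has_mean f a -> has_mean g b -> has_mean (fun x => f x + g x) (a + b).
Proof.
move=> [fi fa] [gi gb]; split; first exact: (integrableD _ fi gi).
by rewrite (@integralD_EFin _ _ _ P setT measurableT f g)//= fa gb.
Qed.

Lemma has_meanZ f a k : has_mean f a -> has_mean (fun x => k * f x) (k * a).
Proof.
move=> [fi fa]; split; first exact: (integrableZl _ k fi).
by under eq_integral do rewrite EFinM; rewrite integralZl// fa.
Qed.

Lemma has_mean_sum (I : finType) (f : I -> X -> R) (a : I -> R) :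
  (forall i, has_mean (f i) (a i)) ->
  has_mean (fun x => \sum_i f i x) (\sum_i a i).
Proof.
move=> fa; elim: (index_enum I) => [|i s IH].
  rewrite big_nil (_ : (fun _ => _) = fun=> 0); first exact: has_mean_cst.
  by apply/funext => x; rewrite big_nil.
rewrite big_cons (_ : (fun _ => _) = fun x => f i x + \sum_(j <- s) f j x).
  exact: has_meanD.
by apply/funext => x; rewrite big_cons.
Qed.

End has_mean.

(** * Integration against a measure given by a density *)

Section density.
Context d (X : measurableType d) (R : realType).
Local Open Scope ereal_scope.

(** [g] and the Radon-Nikodym derivative have equal integrals over every measurable set, so they
    agree almost everywhere. *)
Lemma ge0_integral_density (nu : {finite_measure set X -> \bar R})
    (mu : {sigma_finite_measure set X -> \bar R}) (g f : X -> \bar R) :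
  nu `<< mu -> mu.-integrable setT g ->
  (forall A, measurable A -> nu A = \int[mu]_(x in A) g x) ->
  (forall x, 0 <= f x) -> measurable_fun setT f ->
  \int[nu]_x f x = \int[mu]_x (f x * g x).
Proof.
move=> numu gi nug f0 mf.
rewrite -(Radon_Nikodym_SigmaFinite.change_of_variables numu)//.
have ri := Radon_Nikodym_SigmaFinite.f_integrable numu.
apply: ae_eq_integral => //.
- by apply: emeasurable_funM => //; exact: measurable_int ri.
- by apply: emeasurable_funM => //; exact: measurable_int gi.
- apply: ae_eqe_mul2l; apply: integral_ae_eq => //; first exact: measurable_int gi.
  by move=> A _ mA; rewrite -nug// -Radon_Nikodym_SigmaFinite.f_integral.
Qed.

End density.

(** * Exponential moments and mean of a possibly degenerate normal law *)

Section normal_law_moments.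
Context (R : realType).

(** Completing the square: exponential tilting only shifts the mean by [t * s ^+ 2], so the tilted
    density integrates to the constant in front. *)
Lemma expR_mul_normal_pdf (m s t x : R) : s != 0 ->
  expR (t * x) * normal_pdf m s x =
  expR (t * m + t ^+ 2 * s ^+ 2 / 2) * normal_pdf (m + t * s ^+ 2) s x.
Proof.
move=> s0; rewrite !normal_pdfE// /normal_fun !(mulrCA (expR _)) -!expRD.
by congr (_ * expR _); field.
Qed.

Lemma normal_prob_mgf (m s t : R) : s != 0 ->
  (\int[normal_prob m s]_x (expR (t * x))%:E =
   (expR (t * m + t ^+ 2 * s ^+ 2 / 2))%:E)%E.
Proof.
move=> s0.
rewrite (@ge0_integral_density _ _ _ (normal_prob m s) lebesgue_measure
  (fun x => (normal_pdf m s x)%:E))//.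
- under eq_integral do rewrite -EFinM expR_mul_normal_pdf// EFinM.
  by rewrite integralZl ?integral_normal_pdf ?mule1//; exact: integrable_normal_pdf.
- exact: normal_prob_dominates.
- exact: integrable_normal_pdf.
- by apply/measurable_EFinP; exact: measurableT_comp.
Qed.

Context d (X : measurableType d) (P : probability X R).
Variables (f : X -> R) (m v : R).
Hypotheses (mf : measurable_fun setT f) (v0 : 0 <= v)
  (fE : forall A, measurable A -> P (f @^-1` A) = normal_law m v A).

Lemma normal_law_mgf t :
  has_mean P (fun x => expR (t * f x)) (expR (t * m + t ^+ 2 * v / 2)).
Proof.
have me : measurable_fun setT (fun x : R => (expR (t * x))%:E).
  by apply/measurable_EFinP; exact: measurableT_comp.
have E : (\int[P]_x (expR (t * f x))%:E = (expR (t * m + t ^+ 2 * v / 2))%:E)%E.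
  have [vE|vN0] := eqVneq v 0.
    transitivity (\int[pushforward P f]_y (expR (t * y))%:E)%E.
      by rewrite ge0_integral_pushforward// => y _; rewrite lee_fin expR_ge0.
    rewrite (eq_measure_integral (\d_m)); last first.
      by move=> A mA _; rewrite /= /pushforward fE// /normal_law vE eqxx.
    by rewrite integral_dirac// diracT mul1e vE mulr0 mul0r addr0.
  (* [normal_prob] lives on [measurableTypeR R], whose display differs from that of [R]. *)
  pose f' : X -> measurableTypeR R := f.
  have mf' : measurable_fun setT f' by exact: mf.
  transitivity (\int[pushforward P f']_y (expR (t * y))%:E)%E.
    by rewrite ge0_integral_pushforward// => y _; rewrite lee_fin expR_ge0.
  rewrite (eq_measure_integral (normal_prob m (Num.sqrt v))); last first.
    by move=> A mA _; rewrite /= /pushforward fE// /normal_law (negbTE vN0).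
  rewrite normal_prob_mgf ?sqr_sqrtr// sqrtr_eq0 -ltNge.
  by rewrite lt_neqAle eq_sym vN0.
split=> //; apply/integrableP; split; first exact: measurableT_comp me mf.
by under eq_integral do rewrite /= ger0_norm ?expR_ge0//; rewrite E ltry.
Qed.

(** [|f|] is dominated by [exp f + exp (- f)], the exponential moments at 1 and -1. *)
Lemma normal_law_integrable : P.-integrable setT (EFin \o f).
Proof.
have [i1 _] := has_meanD (normal_law_mgf 1) (normal_law_mgf (-1)).
apply: le_integrable i1 => //; first exact/measurable_EFinP.
move=> x _; rewrite lee_fin mul1r mulN1r [leRHS]ger0_norm ?addr_ge0 ?expR_ge0//.
have h1 := expR_ge1Dx (f x); have h2 := expR_ge1Dx (- f x).
have := expR_ge0 (f x); have := expR_ge0 (- f x).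
by rewrite ler_norml; move=> *; lra.
Qed.

(* [1 + t (f - m) <= exp (t (f - m))] integrates to [1 + t b <= exp (t^2 v / 2)] for every [t],
   where [b] is the mean of [f - m]; for small [t] this forces [b = 0]. *)
Lemma normal_law_mean : has_mean P f m.
Proof.
pose a := fine (\int[P]_x (f x)%:E)%E.
have fa : has_mean P f a.
  split; first exact: normal_law_integrable.
  by rewrite fineK// integrable_fin_num//; exact: normal_law_integrable.
suff b0 : (a - m) ^+ 2 <= 0.
  have : (a - m) ^+ 2 == 0 by rewrite eq_le b0 sqr_ge0.
  by rewrite sqrf_eq0 subr_eq0 => /eqP <-.
set b := a - m.
have key t : 1 + t * b <= expR (t ^+ 2 * v / 2).
  have [_ i1] := has_meanD (has_mean_cst P (1 - t * m)) (has_meanZ t fa).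
  have [_ i2] := has_meanZ (expR (- (t * m))) (normal_law_mgf t).
  rewrite -expRD addKr in i2.
  have -> : 1 + t * b = 1 - t * m + t * a by rewrite /b; ring.
  rewrite -lee_fin -i1 -i2; apply: integral_mono => x.
  rewrite lee_fin -expRD; apply: le_trans (expR_ge1Dx _).
  by rewrite le_eqVlt; apply/orP; left; apply/eqP; ring.
clearbody b; have v_ge0 := v0.
(* [c] exceeds both [v] and [b ^+ 2], so [2 * c ^+ 2 - v * c - b ^+ 2 * v] is positive, and at
   [t = b / c] the bound [key] leaves no room for [b ^+ 2 > 0]. *)
pose c := v + b ^+ 2 + 1; pose t := b / c.
have b20 : 0 <= b ^+ 2 by exact: sqr_ge0.
have c0 : 0 < c by rewrite /c; lra.
have tb : t * b = b ^+ 2 / c by rewrite /t; ring.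
have t0 : 0 <= t * b by rewrite tb; apply: divr_ge0 => //; exact: ltW.
have h1 := expR_ge1Dx (- (t ^+ 2 * v / 2)).
have h : (1 + t * b) * (1 - t ^+ 2 * v / 2) <= 1.
  apply: (@le_trans _ _ ((1 + t * b) * expR (- (t ^+ 2 * v / 2)))).
    by apply: ler_wpM2l h1; rewrite addr_ge0.
  by rewrite expRN ler_pdivrMr ?expR_gt0// mul1r key.
have : b ^+ 2 * (2 * c ^+ 2 - v * c - b ^+ 2 * v) <= 0.
  have -> : b ^+ 2 * (2 * c ^+ 2 - v * c - b ^+ 2 * v) =
     2 * c ^+ 3 * ((1 + t * b) * (1 - t ^+ 2 * v / 2) - 1).
    by rewrite tb /t; field; rewrite gt_eqF.
  by rewrite pmulr_rle0 ?subr_le0// mulr_gt0// exprn_gt0.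
rewrite pmulr_lle0//.
have := mulr_ge0 v_ge0 b20; rewrite /c; nra.
Qed.

End normal_law_moments.

(** * The Gibbs variational inequality *)

Section gibbs.
Context d (X : measurableType d) (R : realType) (p q : probability X R).

(** A zero integral would make [exp h] vanish almost everywhere, so a null set would cover the whole
    space. *)
Lemma integral_expR_gt0 (h : X -> R) : measurable_fun setT h ->
  (0 < \int[p]_x (expR (h x))%:E)%E.
Proof.
move=> mh; have me : measurable_fun setT (EFin \o (expR \o h)).
  by apply/measurable_EFinP; exact: measurableT_comp.
rewrite lt_neqAle integral_ge0 ?andbT; last by move=> x _; rewrite lee_fin expR_ge0.
apply/eqP => /esym D0.
have [+ _] := ae_eq_integral_abs p measurableT me.
under eq_integral do rewrite /= ger0_norm ?expR_ge0//.
move=> /(_ D0) [N [mN pN0 sN]].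
have : (p setT <= p N)%E.
  apply: le_measure; rewrite ?inE// => x _; apply: sN => /= /(_ Logic.I) [] /eqP.
  by rewrite gt_eqF ?expR_gt0.
by rewrite pN0 probability_setT lee_fin ler10.
Qed.

(* With [r = dq/dp] and [D] the integral of [exp h] against [p], the bound [ln y <= y - 1]
   at [y = exp h / (D r)] reads [h - ln D + 1 - exp h / (D r) <= ln r]; integrate it against [q]. *)
Lemma gibbs_variational (h : X -> R) (a : R) : has_mean q h a ->
  (a%:E - KL q p <= lne (\int[p]_x (expR (h x))%:E))%E.
Proof.
move=> ha; have mh := has_mean_measurable ha.
rewrite /KL; case: pselect => [qp|nqp]; last by rewrite leNye.
have := integral_expR_gt0 mh.
case DE : (\int[p]_x _)%E => [D| |]//; last by rewrite leey.
rewrite lte_fin => D0; rewrite lne_EFin//.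
pose r x := Radon_Nikodym_SigmaFinite.f q p x.
have r0 x : (0 <= r x)%E by exact: Radon_Nikodym_SigmaFinite.f_ge0.
have rfin x : r x \is a fin_num by exact: Radon_Nikodym_SigmaFinite.f_fin_num.
have mr : measurable_fun setT r.
  exact: measurable_int (Radon_Nikodym_SigmaFinite.f_integrable qp).
have me : measurable_fun setT (fun x => expR (h x)) by exact: measurableT_comp.
have mg : measurable_fun setT (fun x => expR (h x) / fine (r x)).
  apply: measurable_funM => //; under eq_fun do rewrite -powR_inv1 ?fine_ge0//.
  by apply: (measurableT_comp (measurable_powR _)); exact: measurableT_comp mr.
have g0 x : 0 <= expR (h x) / fine (r x) by rewrite divr_ge0 ?expR_ge0 ?fine_ge0.
(* Only an inequality: where [r] is 0 the quotient is 0 by convention, and the mass of [exp h] there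
   is dropped. *)
have gD : (\int[q]_x (expR (h x) / fine (r x))%:E <= D%:E)%E.
  rewrite -(Radon_Nikodym_SigmaFinite.change_of_variables qp)//; last first.
    exact/measurable_EFinP.
  rewrite -DE; apply: integral_mono => x.
  rewrite -/(r x) -(fineK (rfin x)) -EFinM lee_fin.
  have [->|rN0] := eqVneq (fine (r x)) 0; first by rewrite mulr0 expR_ge0.
  by rewrite divfK.
pose b := fine (\int[q]_x (expR (h x) / fine (r x))%:E)%E.
have bE : (\int[q]_x (expR (h x) / fine (r x))%:E)%E = b%:E.
  rewrite fineK// ge0_fin_numE ?(le_lt_trans gD) ?ltry//.
  by apply: integral_ge0 => x _; rewrite lee_fin.
have gb : has_mean q (fun x => expR (h x) / fine (r x)) b.
  split=> //; apply/integrableP; split; first exact/measurable_EFinP.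
  by under eq_integral do rewrite /= ger0_norm//; rewrite bE ltry.
have la := has_meanD (has_meanD ha (has_mean_cst q (1 - ln D))) (has_meanZ (- D^-1) gb).
have rN0 : {ae q, forall x, r x != 0%E}.
  have m0 : measurable (r @^-1` [set 0%E]).
    by rewrite -[X in measurable X]setTI; exact: mr.
  exists (r @^-1` [set 0%E]); split => //.
    rewrite (Radon_Nikodym_SigmaFinite.f_integral qp)//.
    by rewrite integral0_eq.
  by move=> x /= /negP; rewrite negbK => /eqP.
(* [KL] is stated with the derivative of a charge; it agrees with [r] up to a [p]-null set, which is
   [q]-null by domination. *)
have rE : {ae q, forall x,
    r x = Radon_Nikodym (charge_of_finite_measure q) p x}.
  have := null_dominates_ae_eq measurableT qp
    (ae_eq_Radon_Nikodym_SigmaFinite qp measurableT).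
  by apply: filterS => x; exact.
set K := (\int[q]_x _)%E.
have lK : (\int[q]_x (h x + (1 - ln D) + - D^-1 * (expR (h x) / fine (r x)))%:E <= K)%E.
  apply: ae_le_integral.
  - exact/measurable_EFinP/has_mean_measurable/la.
  - by apply: measurableT_comp => //; exact: measurable_lne.
  apply: filterS2 rN0 rE => x rN0 <-.
  rewrite -(fineK (rfin x)); have f0 : 0 < fine (r x).
    by rewrite fine_gt0// lt_neqAle eq_sym rN0 r0/= -ge0_fin_numE.
  rewrite lne_EFin// lee_fin.
  have h1 : -1 < expR (h x) / (D * fine (r x)) - 1.
    by rewrite ltrBDl subrr divr_gt0 ?expR_gt0 ?mulr_gt0.
  have := le_ln1Dx h1; rewrite addrC subrK ln_div ?posrE ?expR_gt0 ?mulr_gt0//.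
  rewrite expRK lnM ?posrE// invfM => h2.
  by rewrite mulNr mulrCA; lra.
have bD : b / D <= 1.
  by rewrite ler_pdivrMr// mul1r -lee_fin -bE.
(* The finite lower bound [lK] rules out -oo, and +oo makes the left-hand side -oo. *)
move: lK; rewrite la.2; case: (K) => [k| |]//; last by rewrite leNye.
by rewrite -EFinB !lee_fin mulNr (mulrC D^-1); lra.
Qed.

End gibbs.

(** * Matrix entries and logits as measurable linear forms *)

Section matrix_entries.
Context (R : realType) (m n : nat).

Lemma measurable_mx_entry i j :
  measurable_fun setT (fun M : 'M[R]_(m, n) => M i j).
Proof.
move=> _ B mB; rewrite setTI; apply: sub_sigma_algebra.
by exists i, j, B.
Qed.

Lemma dotvE k (u v : 'cV[R]_k) : dotv u v = \sum_i u i 0 * v i 0.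
Proof. by rewrite /dotv mxE; apply: eq_bigr => i _; rewrite mxE. Qed.

Lemma mulmx_dotv (W : 'M[R]_(m, n)) (u : 'cV[R]_n) k :
  (W *m u) k 0 = dotv u (rowv k W).
Proof. by rewrite dotvE mxE; apply: eq_bigr => i _; rewrite !mxE mulrC. Qed.

Lemma measurable_mulmx_entry (u : 'cV[R]_n) k :
  measurable_fun setT (fun W : 'M[R]_(m, n) => (W *m u) k 0).
Proof.
under eq_fun do rewrite mxE.
apply: measurable_sum => j; apply: measurable_funM => //.
exact: measurable_mx_entry.
Qed.

Lemma dotv_onehot k (u : 'cV[R]_k) c : dotv (onehot R c) u = u c 0.
Proof.
rewrite dotvE (bigD1 c)//= mxE eqxx mul1r big1 ?addr0// => i /negbTE ic.
by rewrite mxE ic mul0r.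
Qed.

Lemma posdefmx_ge0 k (S : 'M[R]_k) u : posdefmx S -> 0 <= dotv u (S *m u).
Proof.
move=> [_ Spos]; have [->|/Spos/ltW//] := eqVneq u 0.
by rewrite mulmx0 dotvE big1// => i _; rewrite mxE mulr0.
Qed.

End matrix_entries.

(** * Lower bounds on the softmax under Gaussian noise *)

Section softmax_bounds.
Context (R : realType).

Lemma ln_le_tangent (x y : R) : 0 < x -> 0 < y -> ln x <= ln y + x / y - 1.
Proof.
move=> x0 y0; have : -1 < x / y - 1 by rewrite ltrBDl subrr divr_gt0.
by move=> /le_ln1Dx; rewrite addrC subrK ln_div ?posrE//; lra.
Qed.

Lemma sum_expR_gt0 n (c : 'I_n) (a : 'I_n -> R) : 0 < \sum_k expR (a k).
Proof.
by rewrite (bigD1 c)//= ltr_pwDl ?expR_gt0// sumr_ge0//.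
Qed.

Lemma softmax_ge0 n (z : 'cV[R]_n) c : 0 <= softmax z c 0.
Proof. by rewrite mxE divr_ge0 ?expR_ge0// sumr_ge0//. Qed.

Lemma softmax_le1 n (z : 'cV[R]_n) c : softmax z c 0 <= 1.
Proof.
by rewrite mxE ler_pdivrMr ?(sum_expR_gt0 c)// mul1r (bigD1 c)//= lerDl sumr_ge0//.
Qed.

(** With [v] the normalizing sum, the softmax is [exp (a_c - ln V) * exp (e_c + ln V - ln v)].
    Linearizing the second factor, then [ln v] at [V], leaves an affine expression in [e_c] and the
    [exp e_k], whose means are known. *)
Lemma softmax_ge_tangent n (a e : 'cV[R]_n) c (V : R) : 0 < V ->
  expR (a c 0 - ln V) * (2 + e c 0 + - V^-1 * \sum_k expR (a k 0) * expR (e k 0))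
    <= softmax (a + e) c 0.
Proof.
move=> V0; rewrite mxE; set v := \sum_j expR ((a + e) j 0).
have -> : \sum_k expR (a k 0) * expR (e k 0) = v.
  by apply: eq_bigr => k _; rewrite mxE expRD.
have v0 : 0 < v by exact: sum_expR_gt0.
have -> : expR ((a + e) c 0) / v = expR (a c 0 - ln V) * expR (e c 0 + ln V - ln v).
  rewrite -[X in _ / X](lnK v0) -expRN -!expRD mxE; congr expR; ring.
apply: ler_wpM2l; first exact: expR_ge0.
apply: le_trans (expR_ge1Dx _); have := ln_le_tangent v0 V0.
by rewrite mulNr (mulrC V^-1); lra.
Qed.

Context (n : nat) (nu : probability 'cV[R]_n R) (s : 'I_n -> R) (c : 'I_n).
Hypothesis nu_mean : has_mean nu (fun e : 'cV[R]_n => e c 0) 0.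
Hypothesis nu_mgf : forall k,
  has_mean nu (fun e : 'cV[R]_n => expR (e k 0)) (expR (s k / 2)).

(** Taking [V] to be the mean of the normalizing sum gives the tangent factor the mean 2 + 0 - 1 =
    1. Since the softmax lies between 0 and 1, its expectation is finite and [fine] preserves it. *)
Lemma expected_softmax_ge (a : 'cV[R]_n) :
  expR (a c 0 - LSE (fun k => a k 0 + s k / 2)) <=
  fine 'E_nu[fun e => dotv (onehot R c) (softmax (a + e))].
Proof.
pose V := \sum_k expR (a k 0 + s k / 2).
have V0 : 0 < V by exact: sum_expR_gt0.
have [_ sE] := has_meanZ (expR (a c 0 - ln V))
  (has_meanD (has_meanD (has_mean_cst nu 2) nu_mean)
    (has_meanZ (- V^-1) (has_mean_sum (fun k => has_meanZ (expR (a k 0)) (nu_mgf k))))).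
have VE : \sum_k expR (a k 0) * expR (s k / 2) = V.
  by apply: eq_bigr => k _; rewrite expRD.
rewrite VE mulNr mulVf ?gt_eqF// in sE.
rewrite expectationE; under eq_integral do rewrite dotv_onehot.
have E1 : (\int[nu]_e (softmax (a + e) c 0)%:E <= 1)%E.
  rewrite -[leRHS](has_mean_cst nu 1).2.
  by apply: integral_mono => e; rewrite lee_fin softmax_le1.
have E0 : (0 <= \int[nu]_e (softmax (a + e) c 0)%:E)%E.
  by apply: integral_ge0 => e _; rewrite lee_fin softmax_ge0.
rewrite -lee_fin fineK; last by rewrite ge0_fin_numE// (le_lt_trans E1) ?ltry.
have -> : expR (a c 0 - LSE (fun k => a k 0 + s k / 2)) =
    expR (a c 0 - ln V) * (2 + 0 - 1) by rewrite /LSE; ring.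
by rewrite -sE; apply: integral_mono => e; rewrite lee_fin; exact: softmax_ge_tangent.
Qed.

End softmax_bounds.

(** * Assembly of the bound for the classification model *)

Theorem theorem2 (R : realType) (Nx Ny Nphi T : nat) (hT : (0 < T)%N)
  (Theta : Type) (phi : 'cV[R]_Nx -> Theta -> 'cV[R]_Nphi) (theta : Theta)
  (x : 'I_T -> 'cV[R]_Nx) (label : 'I_T -> 'I_Ny)
  (sigma2 : 'rV[R]_Ny) (hsigma2 : forall k, 0 <= sigma2 0 k)
  (wbar : 'I_Ny -> 'cV[R]_Nphi) (S : 'I_Ny -> 'M[R]_Nphi)
  (hS : forall k, posdefmx (S k))
  (p : probability 'M[R]_(Ny, Nphi) R) (hp : gaussian_mx_law p)
  (nu : probability 'cV[R]_Ny R) (hnu : gaussian_law nu 0 (diag_mx sigma2))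
  (q : probability 'M[R]_(Ny, Nphi) R) (hq : gaussian_rows_law q wbar S) :
  let phit := fun t => phi (x t) theta in
  ((T%:R^-1)%:E * lne (marginal_likelihood phit label p nu) >=
   (variational_objective phit label wbar S sigma2)%:E
     - (T%:R^-1)%:E * KL q p)%E.
Proof.
cbv zeta; set phit := fun t => phi (x t) theta.
(* Testing the Gaussian law against a one-hot vector isolates one coordinate. *)
have nu_law k (A : set R) : measurable A ->
    nu ((fun e : 'cV[R]_Ny => e k 0) @^-1` A) = normal_law 0 (sigma2 0 k) A.
  move=> mA; have := hnu (onehot R k) A mA; rewrite !dotv_onehot mxE.
  rewrite mul_diag_mx mxE mxE eqxx mulr1 => <-; congr (nu _).
  by apply/funext => e /=; rewrite dotv_onehot.
have nu_mean k : has_mean nu (fun e : 'cV[R]_Ny => e k 0) 0.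
  exact: normal_law_mean (measurable_mx_entry _ _) (hsigma2 k) (nu_law k).
have nu_mgf k : has_mean nu (fun e : 'cV[R]_Ny => expR (e k 0))
    (expR (sigma2 0 k / 2)).
  have := normal_law_mgf (measurable_mx_entry k 0) (hsigma2 k) (nu_law k) 1.
  rewrite mul1r add0r expr1n mul1r; under eq_fun do rewrite mul1r; exact.
have q_law t k (A : set R) : measurable A ->
    q ((fun W : 'M[R]_(Ny, Nphi) => (W *m phit t) k 0) @^-1` A) =
    normal_law (dotv (wbar k) (phit t)) (dotv (phit t) (S k *m phit t)) A.
  move=> mA; have := hq.1 k (phit t) A mA.
  have -> : dotv (wbar k) (phit t) = dotv (phit t) (wbar k).
    by rewrite !dotvE; apply: eq_bigr => i _; rewrite mulrC.
  move=> <-; congr (q _).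
  by apply/funext => W /=; rewrite mulmx_dotv.
have q_var t k := posdefmx_ge0 (phit t) (hS k).
have q_mean t k : has_mean q (fun W : 'M[R]_(Ny, Nphi) => (W *m phit t) k 0)
    (dotv (wbar k) (phit t)).
  exact: normal_law_mean (measurable_mulmx_entry _ _) (q_var t k) (q_law t k).
have q_mgf t k : has_mean q
    (fun W : 'M[R]_(Ny, Nphi) => expR (sigma2 0 k / 2) * expR ((W *m phit t) k 0))
    (expR (dotv (wbar k) (phit t) +
       2^-1 * (dotv (phit t) (S k *m phit t) + sigma2 0 k))).
  have := has_meanZ (expR (sigma2 0 k / 2)) (normal_law_mgf
    (measurable_mulmx_entry (phit t) k) (q_var t k) (q_law t k) 1).
  under eq_fun do rewrite mul1r; rewrite -expRD mul1r expr1n mul1r.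
  by congr (has_mean q _ (expR _)); field.
pose a t k := dotv (wbar k) (phit t) +
  2^-1 * (dotv (phit t) (S k *m phit t) + sigma2 0 k).
pose V t := \sum_k expR (a t k).
have V0 t : 0 < V t by exact: (sum_expR_gt0 (label t)).
(* The tangent to [ln] at [V t], the posterior mean of the noise-corrected normalizing sum. The last
   term has mean -1, which cancels the 1 and leaves [L t]. *)
pose h t (W : 'M[R]_(Ny, Nphi)) := (W *m phit t) (label t) 0 + (1 - ln (V t)) +
  - (V t)^-1 * \sum_k expR (sigma2 0 k / 2) * expR ((W *m phit t) k 0).
pose L t := dotv (wbar (label t)) (phit t) - ln (V t).
have h_mean t : has_mean q (h t) (L t).
  have := has_meanD (has_meanD (q_mean t (label t)) (has_mean_cst q (1 - ln (V t))))
    (has_meanZ (- (V t)^-1) (has_mean_sum (q_mgf t))).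
  congr (has_mean q _ _).
  by rewrite -/(V t) mulNr mulVf ?gt_eqF// /L; ring.
have h_le t W : h t W <=
    (W *m phit t) (label t) 0 - LSE (fun k => (W *m phit t) k 0 + sigma2 0 k / 2).
  rewrite /LSE; have := ln_le_tangent
    (sum_expR_gt0 (label t) (fun k => (W *m phit t) k 0 + sigma2 0 k / 2)) (V0 t).
  rewrite /h.
  have -> : \sum_k expR (sigma2 0 k / 2) * expR ((W *m phit t) k 0) =
      \sum_k expR ((W *m phit t) k 0 + sigma2 0 k / 2).
    by apply: eq_bigr => k _; rewrite expRD mulrC.
  by rewrite mulNr (mulrC (V t)^-1); lra.
have ML : (\int[p]_W (expR (\sum_t h t W))%:E <= marginal_likelihood phit label p nu)%E.
  rewrite /marginal_likelihood expectationE; apply: integral_mono => W.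
  rewrite lee_fin expR_sum; apply: ler_prod => t _; rewrite expR_ge0/=.
  apply: le_trans (expected_softmax_ge (nu_mean (label t)) nu_mgf (W *m phit t)).
  by rewrite ler_expR.
have gibbs := gibbs_variational p (has_mean_sum h_mean).
have {gibbs ML} main : ((\sum_t L t)%:E - KL q p <=
    lne (marginal_likelihood phit label p nu))%E.
  apply: (le_trans gibbs); move: ML.
  have m0 : (0 <= \int[p]_W (expR (\sum_t h t W))%:E)%E.
    by apply: integral_ge0 => W _; rewrite lee_fin expR_ge0.
  move=> ML; rewrite lee_lne// in_itv/= leey andbT//.
  exact: le_trans ML.
have -> : variational_objective phit label wbar S sigma2 = T%:R^-1 * \sum_t L t.
  rewrite /variational_objective; congr (_ * _); apply: eq_bigr => t _.
  rewrite dotv_onehot /L; congr (_ - _).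
  rewrite mulmx_dotv !dotvE; apply: eq_bigr => i _.
  by rewrite !mxE mulrC.
(* [KL q p] may be +oo, but the factor and the first term are finite, so distributivity holds. *)
rewrite EFinM -muleBr//.
by rewrite lee_pmul2l// lte_fin invr_gt0 ltr0n.
Qed.
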